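(* There does not exist a structure of a finite-dimensional topological vector space over $\mathbb R$ on the space $E^*$; that is, there is no finite-dimensional topological vector space over $\mathbb R$ that is homeomorphic to $E^*$.
   Context: The space of elliptic Keplerian orbits with marked pericenter is $$E^*=\{(\mathbf c,\mathbf e)\in\mathbb R^3\times\mathbb R^3=\mathbb R^6 : \mathbf c\cdot\mathbf e=0,\ |\mathbf c|>0,\ |\mathbf e|<1\},$$ where $\cdot$ is the standard inner product and $|\cdot|$ the Euclidean norm on $\mathbb R^3$. It carries the topology induced from $\mathbb R^6$. *)

(* Defs.v *)
From HB Require Import structures.
From mathcomp Require Import all_boot all_order all_algebra.
From mathcomp Require Import all_classical all_reals all_analysis.

Set Implicit Arguments.
Unset Strict Implicit.
Unset Printing Implicit Defensive.

Import Order.TTheory GRing.Theory Num.Theory.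
Import numFieldNormedType.Exports.

Local Open Scope classical_set_scope.
Local Open Scope ring_scope.

(* Neither Hausdorff separation nor local convexity is assumed (the library's
   [tvsType] would add local convexity). *)
#[short(type="finDimTvsType")]
HB.structure Definition FinDimTvs (K : numFieldType) :=
  {V of TopologicalLmodule K V & Vector K V}.

Definition homeomorphic (X Y : topologicalType) : Prop :=
  exists (f : X -> Y) (g : Y -> X),
    [/\ cancel f g, cancel g f, continuous f & continuous g].

Definition dot (R : realType) (n : nat) (u v : 'rV[R]_n) : R :=
  \sum_(i < n) u 0 i * v 0 i.

(* The library's norm [`|u|] on ['rV[R]_n] is the sup norm. *)
Definition enorm (R : realType) (n : nat) (u : 'rV[R]_n) : R :=
  Num.sqrt (dot u u).

(* Coerced to a type, this set carries the topology induced by the inclusion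
   into the product ['rV[R]_3 * 'rV[R]_3]. *)
Definition Estar (R : realType) : set ('rV[R]_3 * 'rV[R]_3) :=
  [set ce | [/\ dot ce.1 ce.2 = 0, 0 < enorm ce.1 & enorm ce.2 < 1]].
Arguments Estar R : clear implicits.

(* Main.v *)
Require Import Defs.
From HB Require Import structures.
From mathcomp Require Import all_boot all_order all_algebra.
From mathcomp Require Import all_classical all_reals all_analysis.
From mathcomp Require Import ring lra.

(** A topological vector space [V] contracts to its origin by [(t, v) |-> t v],
    so a homeomorphism with [V] would contract E*.  The circular orbits
    ([e = 0]) contain a copy of the unit sphere of the vectors [c], and the
    homotopy would deform the inclusion of this sphere into R^3 \ {0} to a
    constant.  The proof shows that this is impossible by an explicit form of
    the non-triviality of the Hopf fibration.

    The Hopf map sends a spinor [s = (s1, s2)] in C^2 to a vector of R^3 of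
    length |s|^2.  Given vectors [p] and [q] at an acute angle, a spinor over a
    positive multiple of [p] is carried continuously to one over a positive
    multiple of [q] by the matrix |q| + q.sigma, where sigma is the triple of
    Pauli matrices.  Spinors can therefore be followed along
    homotopies ([spinor_lift]): from a constant spinor at the start, a
    contraction of the sphere would lead to a spinor over each point of the
    sphere, depending continuously on the point.  On the upper hemisphere
    such a spinor has [s1 <> 0], on the lower one [s2 <> 0], and over the
    equatorial point [w] of the unit circle, conj(s1) s2 is a positive multiple
    of [w].

    The same transport in dimension two, where the Hopf map is replaced by the
    complex square [s |-> s^2] and the Pauli action by
    [s |-> q conj(s) + |q| s], gives continuous square roots, up to positive
    factors, of [s1] and [s2] over the two hemispheres, which are discs
    ([square_root_on_box]).  So the identity of the unit circle would have a
    continuous square root up to positive factors, and connectedness of the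
    circle forbids it ([no_circle_square_root]). *)

Set Implicit Arguments.
Unset Strict Implicit.
Unset Printing Implicit Defensive.

Import numFieldNormedType.Exports.
Import Order.TTheory GRing.Theory Num.Theory.
Local Open Scope classical_set_scope.
Local Open Scope ring_scope.

(** * Homotopies parametrised by the line *)

(** The set where [Q] holds is open and closed, and the line is connected. *)
Lemma real_local_equivalence (R : realType) (Q : R -> Prop) (a b : R) :
  (forall t, \forall u \near t, Q t <-> Q u) -> Q a -> Q b.
Proof.
move=> locQ Qa; suff -> // : Q = setT by [].
have cR : connected [set: R] by apply/connected_intervalP.
apply: cR; first by exists a.
- exists Q; last by rewrite setTI.
  rewrite openE => t Qt; apply: filterS (locQ t) => u; tauto.
- exists Q; last by rewrite setTI.
  rewrite -openC openE => t /= Qt; apply: filterS (locQ t) => u /=; tauto.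
Qed.

(** * Continuity in coordinates *)

Section Continuity.
Context {R : realType} {T : topologicalType}.

Lemma continuous_mx m n (f : T -> 'M[R]_(m, n)) :
  (forall i j, continuous (fun x => f x i j)) -> continuous f.
Proof.
move=> cf x A [P fP PA].
apply: (@filterS _ _ _ (fun y => forall i j, P i j (f y i j))).
  by move=> y Py; exact: PA.
apply: filter_forall => i; apply: filter_forall => j; exact: cf (fP i j).
Qed.

Lemma continuous_entry m n (f : T -> 'M[R]_(m, n)) i j :
  continuous f -> continuous (fun x => f x i j).
Proof.
move=> cf x; apply: (@continuous_comp _ _ _ f (fun M : 'M[R]_(m, n) => M i j)).
  exact: cf.
exact: coord_continuous.
Qed.

Lemma continuous_pair (U V : topologicalType) (f : T -> U) (g : T -> V) :
  continuous f -> continuous g -> continuous (fun x => (f x, g x)).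
Proof. by move=> cf cg x; apply: cvg_pair; [exact: cf|exact: cg]. Qed.

Lemma continuous_fst_comp (U V : topologicalType) (f : T -> U * V) :
  continuous f -> continuous (fun x => (f x).1).
Proof. by move=> cf x; apply: cvg_comp; [exact: cf|exact: cvg_fst]. Qed.

Lemma continuous_snd_comp (U V : topologicalType) (f : T -> U * V) :
  continuous f -> continuous (fun x => (f x).2).
Proof. by move=> cf x; apply: cvg_comp; [exact: cf|exact: cvg_snd]. Qed.

Lemma continuous_comp_fun (U V : topologicalType) (f : T -> U) (g : U -> V) :
  continuous g -> continuous f -> continuous (fun x => g (f x)).
Proof. by move=> cg cf x; apply: continuous_comp; [exact: cf|exact: cg]. Qed.

Lemma continuous_add (f g : T -> R) :
  continuous f -> continuous g -> continuous (fun x => f x + g x).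
Proof. by move=> cf cg x; apply: cvgD; [exact: cf|exact: cg]. Qed.

Lemma continuous_opp (f : T -> R) :
  continuous f -> continuous (fun x => - f x).
Proof. by move=> cf x; apply: cvgN; exact: cf. Qed.

Lemma continuous_mul (f g : T -> R) :
  continuous f -> continuous g -> continuous (fun x => f x * g x).
Proof. by move=> cf cg x; apply: cvgM; [exact: cf|exact: cg]. Qed.

Lemma continuous_exp (f : T -> R) k :
  continuous f -> continuous (fun x => f x ^+ k).
Proof.
move=> cf; elim: k => [|k IH].
  by under eq_fun do rewrite expr0; move=> x; exact: cvg_cst.
by under eq_fun do rewrite exprS; exact: continuous_mul.
Qed.

Lemma continuous_dot n (f g : T -> 'rV[R]_n) :
  continuous f -> continuous g -> continuous (fun x => dot (f x) (g x)).
Proof.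
move=> cf cg x; apply: cvg_big => [|i _]; first exact: add_continuous.
by apply: continuous_mul; apply: continuous_entry.
Qed.

Lemma continuous_enorm n (f : T -> 'rV[R]_n) :
  continuous f -> continuous (fun x => enorm (f x)).
Proof.
move=> cf; apply: (continuous_comp_fun (@sqrt_continuous R)).
exact: continuous_dot.
Qed.

End Continuity.

Lemma continuous_id (T : topologicalType) : continuous (fun x : T => x).
Proof. by move=> x; exact: cvg_id. Qed.

Ltac cont := repeat (try assumption;
  lazymatch goal with |- forall x : _, @continuous_at _ _ x ?F =>
  lazymatch F with
  | fun x => x => exact: continuous_id
  | fun x => @?f x + @?g x => apply: (@continuous_add _ _ f g)
  | fun x => - @?f x => apply: (@continuous_opp _ _ f)
  | fun x => @?f x ^+ _ => apply: (@continuous_exp _ _ f)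
  | fun x => @?f x * @?g x => apply: (@continuous_mul _ _ f g)
  | fun x => (@?f x, @?g x) =>
      apply: (@continuous_pair _ _ _ f g)
  | pair ?c => apply: (@continuous_pair _ _ _ (fun=> c) idfun)
  | idfun => exact: continuous_id
  | fun x => fst (@?f x) =>
      apply: (@continuous_fst_comp _ _ _ f)
  | fun x => snd (@?f x) =>
      apply: (@continuous_snd_comp _ _ _ f)
  | fun x => fun_of_matrix (@?f x) _ _ =>
      apply: (@continuous_entry _ _ _ _ f)
  | fun x => enorm (@?f x) => apply: (@continuous_enorm _ _ _ f)
  | fun x => dot (@?f x) (@?g x) =>
      apply: (@continuous_dot _ _ _ f g)
  | _ => exact: cst_continuous
  end end).

(** * Lifting homotopies through a quadratic map *)

Section Dot.
Context {R : realType} {n : nat}.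
Implicit Types u v : 'rV[R]_n.

Lemma dotC u v : dot u v = dot v u.
Proof. by apply: eq_bigr => i _; rewrite mulrC. Qed.

Lemma dotZr u l v : dot u (l *: v) = l * dot u v.
Proof. by rewrite mulr_sumr; apply: eq_bigr => i _; rewrite mxE mulrCA. Qed.

Lemma dot_ge0 u : 0 <= dot u u.
Proof. by apply: sumr_ge0 => i _; rewrite -expr2 sqr_ge0. Qed.

Lemma sqr_enorm u : enorm u ^+ 2 = dot u u.
Proof. by rewrite sqr_sqrtr ?dot_ge0. Qed.

End Dot.

(** The complex square C -> R^2 and the Hopf map C^2 -> R^3 share the structure
    below: a quadratic map [sq], a squared norm [N], and for each vector [q] a
    linear map [turn (q, _)], twice |q| times the orthogonal projection of the
    spinors onto those whose [sq] is a nonnegative multiple of [q]. *)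
Section SpinorLift.
Context {R : realType} {n : nat} {S : topologicalType}.
Variables (sq : S -> 'rV[R]_n) (N : S -> R) (turn : 'rV[R]_n * S -> S).
Hypothesis turn_continuous : continuous turn.
Hypothesis N_ge0 : forall s, 0 <= N s.
Hypothesis sq_turn : forall q s,
  sq (turn (q, s)) = (2 * (enorm q * N s + dot q (sq s))) *: q.
Hypothesis antipodes : exists s s', [/\ 0 < N s, N s' = N s & sq s' = - sq s].

Definition above (p : 'rV[R]_n) (s : S) := exists2 l, 0 < l & sq s = l *: p.

(** An acute angle between [p] and [q] makes the factor in [sq_turn] positive,
    so that the projection does not vanish. *)
Lemma above_turn p q s : 0 < dot p q -> above p s -> above q (turn (q, s)).
Proof.
move=> pq [l l0 sqs]; exists (2 * (enorm q * N s + dot q (sq s))) => //.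
rewrite mulr_gt0// ltr_wpDl ?mulr_ge0 ?sqrtr_ge0// sqs dotZr dotC.
exact: mulr_gt0.
Qed.

(** The factors in [sq_turn] for [s] and [s'] add up to a positive number, so
    projecting one of these two spinors succeeds. *)
Lemma above_exists p : 0 < enorm p -> exists s, above p s.
Proof.
move=> p0; have [s [s' [Ns Ns' sqs']]] := antipodes.
have e : (enorm p * N s + dot p (sq s)) + (enorm p * N s' + dot p (sq s')) =
   2 * (enorm p * N s).
  by rewrite Ns' sqs' -scaleN1r dotZr; ring.
have := mulr_gt0 p0 Ns.
have [h _|h h'] := ltP 0 (enorm p * N s + dot p (sq s)).
  exists (turn (p, s)), (2 * (enorm p * N s + dot p (sq s))) => //.
  exact: mulr_gt0.
exists (turn (p, s')), (2 * (enorm p * N s' + dot p (sq s'))) => //.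
lra.
Qed.

(** By compactness of [K], two stages [h (t, _)] and [h (u, _)] with [u] close
    to [t] make acute angles over all of [K], so [above_turn] carries lifts from
    each one to the other. *)
Lemma spinor_lift (T : topologicalType) (K : set T)
    (h : R * T -> 'rV[R]_n) (x0 : T) :
    compact K -> K x0 -> continuous h ->
    (forall t x, K x -> 0 < enorm (h (t, x))) ->
    (forall x, h (0, x) = h (0, x0)) ->
  exists2 s : T -> S, continuous s & forall x, K x -> above (h (1, x)) (s x).
Proof.
move=> cK Kx0 ch h0 hconst.
pose Q t := exists2 s : T -> S, continuous s &
  forall x, K x -> above (h (t, x)) (s x).
apply: (@real_local_equivalence _ Q 0 1); last first.
  have [|s ps] := @above_exists (h (0, x0)); first exact: h0.
  by exists (fun=> s); [exact: cst_continuous|move=> x _; rewrite hconst].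
have transport v v' : K `<=` (fun x => 0 < dot (h (v, x)) (h (v', x))) ->
    Q v -> Q v'.
  move=> vv' [s cs ps]; exists (fun x => turn (h (v', x), s x)).
    apply: (continuous_comp_fun turn_continuous); cont.
    by apply: (continuous_comp_fun ch); cont.
  by move=> x Kx; apply: above_turn (vv' x Kx) (ps x Kx).
move=> t.
have near_t : \forall u \near t,
    K `<=` (fun x => 0 < dot (h (t, x)) (h (u, x))).
  apply: ((compact_near_coveringP K).1 cK R (nbhs t)
    (fun u x => 0 < dot (h (t, x)) (h (u, x)))) => x Kx.
  pose g (z : T * R) := dot (h (t, z.1)) (h (z.2, z.1)).
  have cg : continuous g.
    by rewrite /g; cont; apply: (continuous_comp_fun ch); cont.
  have g0 : 0 < g (x, t) by rewrite /g/= -sqr_enorm exprn_gt0// h0.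
  exact: cg (lt_nbhsr g0).
apply: filterS near_t => u hu.
by split; apply: transport => // x /hu; rewrite dotC.
Qed.

End SpinorLift.

(** * Coordinates in dimensions two and three *)

Section Rows.
Context {R : realType}.

Definition row2 (a b : R) : 'rV[R]_2 := \row_i [:: a; b]`_i.
Definition row3 (a b c : R) : 'rV[R]_3 := \row_i [:: a; b; c]`_i.

Lemma row2P (u v : 'rV[R]_2) : u 0 0 = v 0 0 -> u 0 1 = v 0 1 -> u = v.
Proof.
move=> e0 e1; apply/rowP => -[[|[|//]] lt_i].
- by rewrite (_ : Ordinal _ = 0) //; exact: val_inj.
- by rewrite (_ : Ordinal _ = 1) //; exact: val_inj.
Qed.

Lemma row3P (u v : 'rV[R]_3) :
  u 0 0 = v 0 0 -> u 0 1 = v 0 1 -> u 0 2%:R = v 0 2%:R -> u = v.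
Proof.
move=> e0 e1 e2; apply/rowP => -[[|[|[|//]]] lt_i].
- by rewrite (_ : Ordinal _ = 0) //; exact: val_inj.
- by rewrite (_ : Ordinal _ = 1) //; exact: val_inj.
- by rewrite (_ : Ordinal _ = 2%:R) //; exact: val_inj.
Qed.

Lemma dot2E (u v : 'rV[R]_2) : dot u v = u 0 0 * v 0 0 + u 0 1 * v 0 1.
Proof.
rewrite /dot !big_ord_recl big_ord0 addr0.
by congr (_ * _ + _ * _); congr (_ _ _); apply: val_inj.
Qed.

Lemma dot3E (u v : 'rV[R]_3) :
  dot u v = u 0 0 * v 0 0 + u 0 1 * v 0 1 + u 0 2%:R * v 0 2%:R.
Proof.
rewrite /dot !big_ord_recl big_ord0 addr0 addrA.
by congr (_ * _ + _ * _ + _ * _); congr (_ _ _); apply: val_inj.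
Qed.

End Rows.

Section ContinuousRows.
Context {R : realType} {T : topologicalType}.

Lemma continuous_row2 (a b : T -> R) :
  continuous a -> continuous b -> continuous (fun x => row2 (a x) (b x)).
Proof.
move=> ca cb; apply: continuous_mx => i [[|[|//]] lt_j];
by under eq_fun do rewrite mxE.
Qed.

Lemma continuous_row3 (a b c : T -> R) :
  continuous a -> continuous b -> continuous c ->
  continuous (fun x => row3 (a x) (b x) (c x)).
Proof.
move=> ca cb cc; apply: continuous_mx => i [[|[|[|//]]] lt_j];
by under eq_fun do rewrite mxE.
Qed.

End ContinuousRows.

(** * Square roots in the plane *)

Section SquareRoot.
Context {R : realType}.

Definition csq (s : R * R) : 'rV[R]_2 :=
  row2 (s.1 ^+ 2 - s.2 ^+ 2) (2 * (s.1 * s.2)).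

Definition cnorm2 (s : R * R) : R := s.1 ^+ 2 + s.2 ^+ 2.

(** In complex notation, [q * conj s + |q| * s]. *)
Definition cturn (z : 'rV[R]_2 * (R * R)) : R * R :=
  let: (q, s) := z in
  (q 0 0 * s.1 + q 0 1 * s.2 + enorm q * s.1,
   q 0 1 * s.1 - q 0 0 * s.2 + enorm q * s.2).

Lemma cturn_continuous : continuous cturn.
Proof.
rewrite (_ : cturn = fun z =>
  (z.1 0 0 * z.2.1 + z.1 0 1 * z.2.2 + enorm z.1 * z.2.1,
   z.1 0 1 * z.2.1 - z.1 0 0 * z.2.2 + enorm z.1 * z.2.2)).
  by cont.
by apply/funext => -[].
Qed.

(** In complex notation,
    (q conj(s) + |q| s)^2 = q (q conj(s)^2 + 2 |q| |s|^2 + conj(q) s^2), and the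
    outer terms of the last factor are conjugate to each other. *)
Lemma csq_turn q s :
  csq (cturn (q, s)) = (2 * (enorm q * cnorm2 s + dot q (csq s))) *: q.
Proof.
have r2 : q 0 1 ^+ 2 = enorm q ^+ 2 - q 0 0 ^+ 2.
  by rewrite sqr_enorm dot2E; ring.
by case: s => a b; apply: row2P; rewrite /cnorm2 dot2E !mxE/=; ring: r2.
Qed.

Lemma square_root_lift (h : R * (R * R) -> 'rV[R]_2) (K : set (R * R)) x0 :
    compact K -> K x0 -> continuous h ->
    (forall t x, K x -> 0 < enorm (h (t, x))) ->
    (forall x, h (0, x) = h (0, x0)) ->
  exists2 s, continuous s & forall x, K x -> above csq (h (1, x)) (s x).
Proof.
apply: (spinor_lift cturn_continuous _ csq_turn).
  by move=> s; rewrite addr_ge0 ?sqr_ge0.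
(* The square roots of 1 and of -1. *)
exists (1, 0), (0, 1); rewrite /cnorm2/=; split; [lra|ring|].
by apply: row2P; rewrite !mxE/=; ring.
Qed.

End SquareRoot.

(** * The Hopf map *)

Section Hopf.
Context {R : realType}.

(** For [s1 = a + i b] and [s2 = c + i d], the first two coordinates are the
    real and imaginary parts of 2 conj(s1) s2, and the third is
    |s1|^2 - |s2|^2. *)
Definition hopf (s : (R * R) * (R * R)) : 'rV[R]_3 :=
  let: ((a, b), (c, d)) := s in
  row3 (2 * (a * c + b * d)) (2 * (a * d - b * c))
       (a ^+ 2 + b ^+ 2 - (c ^+ 2 + d ^+ 2)).

Definition hnorm2 (s : (R * R) * (R * R)) : R := cnorm2 s.1 + cnorm2 s.2.

(** The Hermitian matrix with rows (|q| + q_2, q_0 - i q_1) and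
    (q_0 + i q_1, |q| - q_2), acting on C^2. *)
Definition pauli (z : 'rV[R]_3 * ((R * R) * (R * R))) : (R * R) * (R * R) :=
  let: (q, ((a, b), (c, d))) := z in
  (((enorm q + q 0 2%:R) * a + (q 0 0 * c + q 0 1 * d),
    (enorm q + q 0 2%:R) * b + (q 0 0 * d - q 0 1 * c)),
   (q 0 0 * a - q 0 1 * b + (enorm q - q 0 2%:R) * c,
    q 0 0 * b + q 0 1 * a + (enorm q - q 0 2%:R) * d)).

Lemma pauli_continuous : continuous pauli.
Proof.
rewrite (_ : pauli = fun z =>
  (((enorm z.1 + z.1 0 2%:R) * z.2.1.1 +
      (z.1 0 0 * z.2.2.1 + z.1 0 1 * z.2.2.2),
    (enorm z.1 + z.1 0 2%:R) * z.2.1.2 +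
      (z.1 0 0 * z.2.2.2 - z.1 0 1 * z.2.2.1)),
   (z.1 0 0 * z.2.1.1 - z.1 0 1 * z.2.1.2 +
      (enorm z.1 - z.1 0 2%:R) * z.2.2.1,
    z.1 0 0 * z.2.1.2 + z.1 0 1 * z.2.1.1 +
      (enorm z.1 - z.1 0 2%:R) * z.2.2.2))).
  by cont.
by apply/funext => -[q [[a b] [c d]]].
Qed.

(** For [q <> 0] the matrix has rank one, and its image is the line of spinors
    whose Hopf image is a nonnegative multiple of [q]. *)
Lemma hopf_pauli q s :
  hopf (pauli (q, s)) = (2 * (enorm q * hnorm2 s + dot q (hopf s))) *: q.
Proof.
have r2 : q 0 2%:R ^+ 2 = enorm q ^+ 2 - q 0 0 ^+ 2 - q 0 1 ^+ 2.
  by rewrite sqr_enorm dot3E; ring.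
case: s => [[a b] [c d]].
by apply: row3P; rewrite /hnorm2 /cnorm2 dot3E !mxE/=; ring: r2.
Qed.

Lemma hopf_lift (T : topologicalType) (h : R * T -> 'rV[R]_3) (K : set T) x0 :
    compact K -> K x0 -> continuous h ->
    (forall t x, K x -> 0 < enorm (h (t, x))) ->
    (forall x, h (0, x) = h (0, x0)) ->
  exists2 s, continuous s & forall x, K x -> above hopf (h (1, x)) (s x).
Proof.
apply: (spinor_lift pauli_continuous _ hopf_pauli).
  by move=> s; rewrite !addr_ge0 ?sqr_ge0.
(* Spinors over the two poles. *)
exists ((1, 0), (0, 0)), ((0, 0), (1, 0)); rewrite /hnorm2 /cnorm2/=.
split; [lra|ring|].
by apply: row3P; rewrite !mxE/=; ring.
Qed.

End Hopf.

(** * No continuous square root on the circle *)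

(** If [r w] and [r (- w)] are square roots of positive multiples of [w] and
    [- w], then r(-w) / r(w) is a nonzero imaginary number, so [det] below does
    not vanish on the circle; it is an odd function of [w], which contradicts
    the intermediate value theorem along a half circle. *)
Lemma no_circle_square_root (R : realType) (r : R * R -> R * R) :
    continuous r ->
  ~ forall w, cnorm2 w = 1 -> above csq (row2 w.1 w.2) (r w).
Proof.
move=> cr sqr.
pose det (a b : R * R) := a.1 * b.2 - a.2 * b.1.
have det_neq0 w : cnorm2 w = 1 -> det (r w) (r (- w.1, - w.2)) != 0.
  move=> w1; have [l l0] := sqr w w1.
  have w1' : cnorm2 (- w.1, - w.2) = 1 by rewrite -w1 /cnorm2 /= !sqrrN.
  have [l' l0' ] := sqr _ w1'.
  case: (r w) (r _) => [a1 a2] [b1 b2] eb ea.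
  move/rowP: ea => ea; move/rowP: eb => eb.
  have := ea 0; have := ea 1; have := eb 0; have := eb 1.
  rewrite !mxE/= => {ea eb} eb1 eb0 ea1 ea0.
  apply/eqP; rewrite /det/= => det0.
  (* If [det] vanished, the squares of [r w] and [r (- w)] would have
     nonnegative inner product, by Lagrange's identity. *)
  have : (a1 * b1 + a2 * b2) ^+ 2 = - (l * l').
    transitivity ((a1 ^+ 2 - a2 ^+ 2) * (b1 ^+ 2 - b2 ^+ 2) +
      2 * (a1 * a2) * (2 * (b1 * b2)) + (a1 * b2 - a2 * b1) ^+ 2).
      by ring.
    rewrite det0 ea0 ea1 eb0 eb1.
    transitivity (- (l * l') * cnorm2 w); first by rewrite /cnorm2; ring.
    by rewrite w1 mulr1.
  have := sqr_ge0 (a1 * b1 + a2 * b2); have := mulr_gt0 l0 l0'; lra.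
pose phi (t : R) := det (r (cos t, sin t)) (r (- cos t, - sin t)).
have cphi : continuous phi.
  rewrite /phi /det; cont; apply: (continuous_comp_fun cr); cont;
    by [exact: continuous_cos|exact: continuous_sin].
have [|||t _ phit] := @IVT _ phi 0 pi 0.
- exact: pi_ge0.
- exact: continuous_subspaceT.
- have -> : phi pi = - phi 0.
    by rewrite /phi cospi sinpi cos0 sin0 oppr0 opprK /det; ring.
  by rewrite ge_min le_max; case: (lerP 0 (phi 0)) => h; apply/andP; split; lra.
by move/eqP: (det_neq0 (cos t, sin t) (cos2Dsin2 t)); apply.
Qed.

(** * A sphere cannot be contracted off the origin *)

(** A compact star-shaped neighbourhood of the closed unit disc. *)
Definition box (R : realType) : set (R * R) :=
  `[-1, 1]%classic `*` `[-1, 1]%classic.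

Lemma box_compact (R : realType) : compact (@box R).
Proof. by apply: compact_setX; exact: segment_compact. Qed.

Lemma boxP (R : realType) (w : R * R) :
  box w <-> `|w.1| <= 1 /\ `|w.2| <= 1.
Proof. by rewrite !ler_norml /box /= !in_itv. Qed.

Lemma box_center (R : realType) : @box R (0, 0).
Proof. by apply/boxP; rewrite normr0. Qed.

(** A function on a star-shaped domain is homotopic to a constant by rescaling
    its argument. *)
Lemma square_root_on_box (R : realType) (f : R * R -> 'rV[R]_2) :
    continuous f -> (forall w, box w -> 0 < enorm (f w)) ->
  exists2 s, continuous s & forall w, box w -> above csq (f w) (s w).
Proof.
move=> cf f0.
(* The scaling factor must be 0 at time 0, 1 at time 1, and stay in [-1, 1] at
   all real times. *)
pose h (z : R * (R * R)) :=
  f (sin (z.1 * (pi / 2)) * z.2.1, sin (z.1 * (pi / 2)) * z.2.2).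
have [|||s cs ps] :=
  @square_root_lift R h _ (0, 0) (@box_compact R) (@box_center R).
- apply: (continuous_comp_fun cf); cont;
    apply: (continuous_comp_fun (@continuous_sin R)); cont.
- move=> t x /boxP[x1 x2]; apply: f0; apply/boxP.
  by rewrite /= !normrM !mulr_ile1// ler_norml sin_geN1 sin_le1.
- by move=> x; rewrite /h/= !mul0r sin0 !mul0r.
exists s => // w Dw; move: (ps w Dw).
by rewrite /h/= mul1r sin_pihalf !mul1r -surjective_pairing.
Qed.

(** The Hopf map sends a spinor with [s1 = 0] to the closed negative vertical
    half-axis, which the surface [w |-> (2 w, 1 - |w|^2)] does not meet. *)
Lemma above_hopf_upper (R : realType) (w : R * R) s :
  above hopf (row3 (2 * w.1) (2 * w.2) (1 - cnorm2 w)) s -> 0 < cnorm2 s.1.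
Proof.
case: s => [[a b] [c d]] [l l0 /rowP e].
have := e 0; have := e 1; have := e 2%:R.
rewrite !mxE /cnorm2 /= => {e} e2 e1 e0.
rewrite lt_def addr_ge0 ?sqr_ge0// andbT paddr_eq0 ?sqr_ge0// !sqrf_eq0.
apply/negP => /andP[/eqP a0 /eqP b0]; subst a b.
have w1 : w.1 = 0.
  have : l * w.1 = 0 by lra.
  by move/eqP; rewrite mulf_eq0 (gt_eqF l0) => /eqP.
have w2 : w.2 = 0.
  have : l * w.2 = 0 by lra.
  by move/eqP; rewrite mulf_eq0 (gt_eqF l0) => /eqP.
have := sqr_ge0 c; have := sqr_ge0 d; move: e2; rewrite w1 w2; lra.
Qed.

Lemma above_hopf_lower (R : realType) (w : R * R) s :
  above hopf (row3 (2 * w.1) (2 * w.2) (cnorm2 w - 1)) s -> 0 < cnorm2 s.2.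
Proof.
case: s => [[a b] [c d]] [l l0 /rowP e].
(* Exchanging the components of a spinor turns its Hopf image by a half turn
   around the first axis. *)
apply: (@above_hopf_upper _ (w.1, - w.2) ((c, d), (a, b))); exists l => //.
have := e 0; have := e 1; have := e 2%:R.
rewrite !mxE /cnorm2 /= => {e} e2 e1 e0.
apply: row3P; rewrite !mxE/=; lra.
Qed.

(** The surfaces [up] and [lo] project from the origin, by inverse
    stereographic projection, onto the two hemispheres of the unit sphere when
    [w] runs over the unit disc, and they are glued along the equator. *)
Lemma no_contraction (R : realType) (E : topologicalType) (c : E -> 'rV[R]_3)
    (up lo : R * R -> E) (H : R * E -> E) :
    continuous c -> (forall x, 0 < enorm (c x)) ->
    continuous up -> continuous lo ->
    (forall w, c (up w) = row3 (2 * w.1) (2 * w.2) (1 - cnorm2 w)) ->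
    (forall w, c (lo w) = row3 (2 * w.1) (2 * w.2) (cnorm2 w - 1)) ->
    (forall w, cnorm2 w = 1 -> up w = lo w) ->
    continuous H -> (forall x y, H (0, x) = H (0, y)) ->
  ~ forall x, H (1, x) = x.
Proof.
move=> cc c0 cup clo cupE cloE uplo cH H0 H1.
pose K := up @` @box R `|` lo @` @box R.
have cK : compact K.
  apply: compactU; apply: continuous_compact (@box_compact R);
    exact: continuous_subspaceT.
have [||||s cs ps] := @hopf_lift R E (fun z => c (H z)) K (up (0, 0)) cK.
- by left; exists (0, 0) => //; exact: box_center.
- exact: continuous_comp_fun.
- by move=> *; exact: c0.
- by move=> x; rewrite (H0 x (up (0, 0))).
have sup w : box w ->
    above hopf (row3 (2 * w.1) (2 * w.2) (1 - cnorm2 w)) (s (up w)).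
  by move=> Dw; rewrite -cupE -{1}(H1 (up w)); apply: ps; left; exists w.
have slo w : box w ->
    above hopf (row3 (2 * w.1) (2 * w.2) (cnorm2 w - 1)) (s (lo w)).
  by move=> Dw; rewrite -cloE -{1}(H1 (lo w)); apply: ps; right; exists w.
have row_gt0 (z : R * R) : 0 < cnorm2 z -> 0 < enorm (row2 z.1 z.2).
  by rewrite sqrtr_gt0 dot2E !mxE.
have [||F cF pF] := @square_root_on_box R
    (fun w => row2 (s (up w)).1.1 (s (up w)).1.2).
- by apply: continuous_row2; cont; exact: (continuous_comp_fun cs).
- by move=> w Dw; apply: row_gt0 (above_hopf_upper (sup w Dw)).
have [||G cG pG] := @square_root_on_box R
    (fun w => row2 (s (lo w)).2.1 (s (lo w)).2.2).
- by apply: continuous_row2; cont; exact: (continuous_comp_fun cs).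
- by move=> w Dw; apply: row_gt0 (above_hopf_lower (slo w Dw)).
(* In complex notation, the function conj(F) G: its square is a positive
   multiple of conj(s1) s2, hence of [w]. *)
apply: (@no_circle_square_root R (fun w =>
  ((F w).1 * (G w).1 + (F w).2 * (G w).2,
   (F w).1 * (G w).2 - (F w).2 * (G w).1))); first by cont.
move=> w w1.
have Dw : box w.
  have := sqr_ge0 w.1; have := sqr_ge0 w.2; rewrite /cnorm2 in w1 * => h2 h1.
  by apply/boxP; rewrite !ler_norml; split; apply/andP; split; nra.
have [l l0 sl] := sup w Dw; have [m m0 Fm] := pF w Dw.
have [n n0 Gn] := pG w Dw; exists (l * m * n); first by rewrite !mulr_gt0.
rewrite -uplo// in Gn.
move: sl Fm Gn; rewrite w1.
case: (s _) (F w) (G w) => [[a b] [x d]] [F1 F2] [G1 G2].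
move=> /rowP sl /rowP Fm /rowP Gn.
have := sl 0; have := sl 1; have := Fm 0; have := Fm 1.
have := Gn 0; have := Gn 1.
rewrite !mxE/= => {sl Fm Gn} Gn1 Gn0 Fm1 Fm0 sl1 sl0.
have sl0' : a * x + b * d = l * w.1 by lra.
have sl1' : a * d - b * x = l * w.2 by lra.
apply: row2P; rewrite !mxE/=.
- transitivity ((F1 ^+ 2 - F2 ^+ 2) * (G1 ^+ 2 - G2 ^+ 2) +
     (2 * (F1 * F2)) * (2 * (G1 * G2))); first by ring.
  rewrite Fm0 Fm1 Gn0 Gn1.
  transitivity (m * n * (a * x + b * d)); first by ring.
  by rewrite sl0'; ring.
- transitivity ((F1 ^+ 2 - F2 ^+ 2) * (2 * (G1 * G2)) -
     (2 * (F1 * F2)) * (G1 ^+ 2 - G2 ^+ 2)); first by ring.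
  rewrite Fm0 Fm1 Gn0 Gn1.
  transitivity (m * n * (a * d - b * x)); first by ring.
  by rewrite sl1'; ring.
Qed.

(** * The space of orbits *)

(** With [e = 0] any nonzero [c] is allowed, so that maps into R^3 \ {0} lift to
    the space of orbits. *)
Lemma circular_orbits (R : realType) (T : topologicalType) (c : T -> 'rV[R]_3) :
    continuous c -> (forall w, 0 < enorm (c w)) ->
  exists2 j : T -> set_type (Estar R),
    continuous j & forall w, set_val (j w) = (c w, 0).
Proof.
move=> cc c0.
have Ec w : Estar R (c w, 0).
  have d0 v : dot v (0 : 'rV[R]_3) = 0 by apply: big1 => i _; rewrite mxE mulr0.
  by split; rewrite //= /enorm d0 ?sqrtr0.
exists (fun w => exist _ (c w, 0) (mem_set (Ec w))) => //.
apply: continuous_comp_initial.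
have cj : continuous (fun w => (c w, 0 : 'rV[R]_3)) by cont.
exact: cj.
Qed.

Theorem theorem3 (R : realType) :
  ~ exists V : finDimTvsType R, homeomorphic V (set_type (Estar R)).
Proof.
case=> V [f [g [fK gK cf cg]]].
pose H (z : R * set_type (Estar R)) := f (z.1 *: g z.2).
have cH : continuous H.
  apply: (continuous_comp_fun cf).
  apply: (@continuous_comp_fun _ (R^o * V)%type V (fun z => (z.1, g z.2))
    (fun z => z.1 *: z.2)); first exact: scale_continuous.
  apply: continuous_pair; first by move=> z; exact: cvg_fst.
  by apply: (continuous_comp_fun cg) => z; exact: cvg_snd.
(* Both surfaces avoid the origin as 4 |w|^2 + (1 - |w|^2)^2 = (1 + |w|^2)^2. *)
have sphere_gt0 (w : R * R) k : k ^+ 2 = (1 - cnorm2 w) ^+ 2 ->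
    0 < enorm (row3 (2 * w.1) (2 * w.2) k).
  move=> k2; rewrite sqrtr_gt0 dot3E !mxE/= -!expr2 k2 /cnorm2.
  have := sqr_ge0 w.1; have := sqr_ge0 w.2; nra.
have crow (k : R * R -> R) : continuous k ->
    continuous (fun w : R * R => row3 (2 * w.1) (2 * w.2) (k w)).
  by move=> ck; apply: continuous_row3; cont.
have [||up cup upE] := @circular_orbits R (R * R)%type
  (fun w => row3 (2 * w.1) (2 * w.2) (1 - cnorm2 w)).
- by apply: crow; rewrite /cnorm2; cont.
- by move=> w; exact: sphere_gt0.
have [||lo clo loE] := @circular_orbits R (R * R)%type
  (fun w => row3 (2 * w.1) (2 * w.2) (cnorm2 w - 1)).
- by apply: crow; rewrite /cnorm2; cont.
- by move=> w; apply: sphere_gt0; ring.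
apply: (@no_contraction R (set_type (Estar R))
  (fun x => (set_val x).1) up lo H).
- by apply: continuous_fst_comp; exact: initial_continuous.
- by move=> [x xE]; have [] := set_mem xE.
- exact: cup.
- exact: clo.
- by move=> w; rewrite upE.
- by move=> w; rewrite loE.
- by move=> w w1; apply: val_inj; rewrite -!set_valE upE loE w1 subrr.
- exact: cH.
- by move=> x y; rewrite /H/= !scale0r.
- by move=> x; rewrite /H/= scale1r gK.
Qed.
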